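(* For any connected graph $H$ that is both multicyclic and leaf-free, and any integer $m\ge2$, the expected number of copies of $H$ in the uniform attachment graph $G^m_n$ is bounded as $n\to\infty$.
   Context: Uniform attachment graph: for integers $m,n\ge1$, $G^m_n$ is the random loopless multigraph on vertex set $[n]=\{1,\dots,n\}$ in which, for every $j\in\{2,\dots,n\}$ and every label $a\in[m]$, there is exactly one edge $j^{(a)}$ with label $a$ from $j$ to a vertex chosen uniformly at random in $[j-1]$, all choices being independent. Parallel edges are allowed and are distinguished by their labels. Graphs are finite and may be loopless multigraphs (a pair of parallel edges is a cycle of length 2). A copy of $H$ in $G^m_n$ is a (not necessarily induced) subgraph of $G^m_n$ isomorphic to $H$ as an undirected, unlabelled multigraph; two copies are different if they differ as subgraphs (also if they differ only in edge labels). A graph is multicyclic if it has at least two (not necessarily edge- or vertex-disjoint) cycles; it is leaf-free if it has no vertex of degree 1. *)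

(* Defs.v *)
From mathcomp Require Import all_boot all_order all_algebra.

Set Implicit Arguments.
Unset Strict Implicit.
Unset Printing Implicit Defensive.

Import Order.TTheory GRing.Theory Num.Theory.

Local Open Scope nat_scope.

(* Edges are objects of their own, so parallel edges are allowed;
   an edge has two distinct ends, so loops are not. *)
Record mgraph := MGraph {
  vertex : finType;
  edge : finType;
  ends : edge -> {set vertex};
  card_ends : forall e, #|ends e| = 2 }.

Definition adjacent (G : mgraph) : rel (vertex G) :=
  fun u v => [exists e : edge G, ends e == [set u; v]].

Definition degree (G : mgraph) (v : vertex G) : nat :=
  #|[set e : edge G | v \in ends e]|.

Definition connected (G : mgraph) : Prop :=
  0 < #|vertex G| /\ forall u v : vertex G, connect (@adjacent G) u v.

Definition leaf_free (G : mgraph) : Prop :=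
  forall v : vertex G, degree v != 1.

(* Candidate subgraphs are pairs (vertex set, edge set). *)
Definition vesets (G : mgraph) : finType :=
  ({set vertex G} * {set edge G})%type.

Definition is_subgraph (G : mgraph) (S : vesets G) : bool :=
  [forall e in S.2, ends e \subset S.1].

(* f and g are injective with images S.1 and S.2, hence bijections from the
   vertices and edges of H onto those of S. *)
Definition isomorphic_to (H G : mgraph) (S : vesets G) : bool :=
  [exists f : {ffun vertex H -> vertex G},
   [exists g : {ffun edge H -> edge G},
     [&& injectiveb f, injectiveb g,
         f @: [set: vertex H] == S.1, g @: [set: edge H] == S.2 &
         [forall e : edge H, ends (g e) == f @: ends e]]]].

Definition is_copy (H G : mgraph) (S : vesets G) : bool :=
  is_subgraph S && isomorphic_to H S.

Definition copies (H G : mgraph) : nat := #|[set S | @is_copy H G S]|.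

Lemma card_cycle_ends (k : nat) (i : 'I_k.+2) : #|[set i; ordS i]| = 2.
Proof.
rewrite cards2; suff -> : i != ordS i by [].
apply/eqP => /(congr1 val) /= e; have := ltn_ord i; rewrite leq_eqVlt eqSS.
case/orP => [/eqP ik | lt_ik]; first by move: e; rewrite ik modnn.
by move: e; rewrite modn_small // => /n_Sn.
Qed.

(* The cycle of length k.+2, with an edge from i to i + 1 mod k.+2 for each i;
   for k = 0 this is a pair of parallel edges. *)
Definition cycle_mgraph (k : nat) : mgraph := MGraph (@card_cycle_ends k).

Definition is_cycle (G : mgraph) (S : vesets G) : Prop :=
  exists k : nat, is_copy (cycle_mgraph k) S.

Definition multicyclic (G : mgraph) : Prop :=
  exists S1 S2 : vesets G, [/\ S1 <> S2, is_cycle S1 & is_cycle S2].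

(* The vertex j of {1, ..., n} is the ordinal j - 1 : 'I_n, so that
   {1, ..., j - 1} is the initial segment 'I_i for i = j - 1. *)
Definition later (n : nat) : finType := {i : 'I_n | 0 < i}.

(* ((i, a) : ua_edge m n) is the edge with label a sent back by i. *)
Definition ua_edge (m n : nat) : finType := (later n * 'I_m)%type.

Definition ua_outcome (m n : nat) : finType :=
  {dffun forall e : ua_edge m n, 'I_(val e.1)}.

Definition ua_source (m n : nat) (e : ua_edge m n) : 'I_n := val e.1.

Definition ua_target (m n : nat) (w : ua_outcome m n) (e : ua_edge m n) : 'I_n :=
  widen_ord (ltnW (ltn_ord (ua_source e))) (w e).

Lemma card_ua_ends (m n : nat) (w : ua_outcome m n) (e : ua_edge m n) :
  #|[set ua_source e; ua_target w e]| = 2.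
Proof.
rewrite cards2; suff -> : ua_source e != ua_target w e by [].
by rewrite -val_eqE neq_ltn /= [w e < _]ltn_ord orbT.
Qed.

Definition ua_graph (m n : nat) (w : ua_outcome m n) : mgraph :=
  MGraph (card_ua_ends w).

Local Open Scope ring_scope.

(* The choices w e are independent, and w e is uniform on the
   ua_source e vertices preceding ua_source e. The probability space is
   finite, so that probabilities and expectations are rational. *)
Definition ua_prob (m n : nat) (w : ua_outcome m n) : rat :=
  \prod_(e : ua_edge m n) (ua_source e)%:R^-1.

Lemma ua_prob_sum1 (m n : nat) : \sum_(w : ua_outcome m n) ua_prob w = 1.
Proof.
rewrite /ua_prob sumr_const card_dep_ffun foldrE big_map big_enum /=.
rewrite -[LHS]mulr_natr natr_prod -big_split big1 //= => -[[i i_gt0] a] _.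
by rewrite card_ord mulVf // pnatr_eq0 -lt0n.
Qed.

Definition ua_expectation (m n : nat) (X : ua_outcome m n -> rat) : rat :=
  \sum_(w : ua_outcome m n) ua_prob w * X w.

Definition expected_copies (H : mgraph) (m n : nat) : rat :=
  ua_expectation (fun w : ua_outcome m n => (copies H (ua_graph w))%:R).

(* Main.v *)
(* Put the vertices of H at positions f : V(H) -> [0, n). Each edge of H must be
   sent back by the later of its ends, so the copies at f contribute at most
   m^|E(H)| * prod_e 1/max_(v in e) f(v), which is at most
   m^|E(H)| * 2^-(sum_e max_(v in e) l v) with l v = floor(log2 (f v)).
   Every nonempty vertex set T meets at least |T| + 1 edges: leaf-freeness gives
   |T|, and equality would make H a single cycle. Summing over the level sets of
   l gives sum_e max_(v in e) l v >= sum_v l v + max l. The surplus max l makes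
   the sum over all f, factorized over the vertices, converge. *)

Require Import Defs.
From mathcomp Require Import all_boot all_order all_algebra.
From mathcomp Require Import lra.

Set Implicit Arguments.
Unset Strict Implicit.
Unset Printing Implicit Defensive.

Import Order.TTheory GRing.Theory Num.Theory.

Local Open Scope nat_scope.

(** * Edges meeting a vertex set of a connected, leaf-free, multicyclic graph *)

Definition touch (G : mgraph) (T : {set vertex G}) : nat :=
  #|[set e : edge G | ends e :&: T != set0]|.

Lemma sum_degree (G : mgraph) (T : {set vertex G}) :
  \sum_(v in T) degree v = \sum_(e : edge G) #|ends e :&: T|.
Proof.
transitivity (\sum_(v in T) \sum_(e : edge G) (v \in ends e : nat)).
  apply: eq_bigr => v _; rewrite /degree -sum1_card big_mkcond /=.
  by apply: eq_bigr => e _; rewrite inE; case: (v \in ends e).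
rewrite exchange_big /=; apply: eq_bigr => e _.
rewrite -sum1_card big_mkcond [RHS]big_mkcond /=.
by apply: eq_bigr => v _; rewrite inE; case: (v \in T); case: (v \in ends e).
Qed.

Lemma closed_vset_full (G : mgraph) (T : {set vertex G}) :
  connected G -> T != set0 ->
  (forall e : edge G, ends e :&: T != set0 -> ends e \subset T) ->
  T = [set: vertex G].
Proof.
case=> _ conn /set0Pn[u uT] closed; apply/setP => v; rewrite inE.
have /connectP[p pth ->] := conn u v.
elim: p u uT pth => //= x p IH u uT /andP[/existsP[e /eqP e_ux] pth].
apply: (IH x) => //; have : ends e \subset T.
  by apply: closed; apply/set0Pn; exists u; rewrite inE e_ux set21.
by rewrite e_ux => /subsetP; apply; rewrite set22.
Qed.

(** Degree 0 would make [[set v]] closed under adjacency, hence by connectivity the whole vertex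
    set, leaving no room for the two ends of an edge. *)
Lemma leaf_free_degree (G : mgraph) (v : vertex G) :
  connected G -> leaf_free G -> edge G -> 2 <= degree v.
Proof.
move=> G_conn G_lf e; move: (G_lf v).
suff : degree v != 0 by case: (degree v) => [|[]].
apply/eqP => /cards0_eq deg0.
have not_in e' : v \notin ends e' by have /setP/(_ e') := deg0; rewrite !inE => ->.
have vT : [set v] = [set: vertex G].
  apply: closed_vset_full => //; first by apply/set0Pn; exists v; rewrite set11.
  by move=> e' /set0Pn[x /setIP[xe /set1P xv]]; rewrite xv (negPf (not_in e')) in xe.
have /card_gt0P[x xe] : 0 < #|ends e| by rewrite card_ends.
have : x \in [set v] by rewrite vT inE.
by move/set1P => xv; rewrite xv (negPf (not_in e)) in xe.
Qed.

Lemma ordS_neq (k : nat) (i : 'I_k.+2) : ordS i != i.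
Proof. by have := card_cycle_ends i; rewrite cards2 eq_sym; case: (_ != _). Qed.

(** Vertex [i] of the cycle is an end of the edges [i] and [ord_pred i], which differ even when the
    length is 2. *)
Lemma cycle_degree (G : mgraph) (S : vesets G) (v : vertex G) :
  is_cycle S -> v \in S.1 -> 2 <= #|[set e in S.2 | v \in ends e]|.
Proof.
case=> k /andP[_ /existsP[f /existsP[g /and5P[_ /injectiveP g_inj]]]].
move=> /eqP fS /eqP gS /forallP ends_g.
rewrite -fS => /imsetP[i _ ->{v}].
have -> : 2 = #|[set g i; g (ord_pred i)]|.
  rewrite cards2 (inj_eq g_inj); suff -> : i != ord_pred i by [].
  by have := ordS_neq (ord_pred i); rewrite ord_predK.
apply/subset_leq_card/subsetP => _ /set2P[] ->;
  rewrite inE -gS imset_f ?inE //= (eqP (ends_g _)) imset_f //= ?set21 //.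
by rewrite ord_predK set22.
Qed.

(** The cycle already uses up the two edges allowed at each of its vertices, so no other edge
    touches it, and connectivity makes it everything. *)
Lemma two_regular_cycle (G : mgraph) (S : vesets G) :
  connected G -> (forall v : vertex G, degree v <= 2) -> is_cycle S ->
  S = ([set: vertex G], [set: edge G]).
Proof.
move=> G_conn deg2 S_cyc.
have /forallP S_sub : is_subgraph S by case: S_cyc => k /andP[].
have inc v e : v \in S.1 -> v \in ends e -> e \in S.2.
  move=> vS ve; have : e \in [set e : edge G | v \in ends e] by rewrite inE.
  have : [set e in S.2 | v \in ends e] = [set e : edge G | v \in ends e].
    apply/eqP; rewrite eqEcard (leq_trans (deg2 v)) ?cycle_degree // andbT.
    by apply/subsetP => e'; rewrite !inE => /andP[].
  by move <-; rewrite inE => /andP[].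
have S1T : S.1 = [set: vertex G].
  apply: closed_vset_full => //.
    case: S_cyc => k /andP[_ /existsP[f /existsP[g /and5P[_ _ /eqP <- _ _]]]].
    by apply/set0Pn; exists (f ord0); rewrite imset_f.
  move=> e /set0Pn[v /setIP[ve vS]]; exact: (implyP (S_sub e) (inc v e vS ve)).
rewrite [LHS]surjective_pairing S1T; congr (_, _); apply/setP => e; rewrite inE.
have /card_gt0P[v ve] : 0 < #|ends e| by rewrite card_ends.
by apply: (inc v) => //; rewrite S1T inE.
Qed.

(* Equality in the degree count over T forces T to be the whole vertex set and
   every degree to be 2, so that the graph is a single cycle. *)
Lemma touch_gt (G : mgraph) (T : {set vertex G}) :
  connected G -> multicyclic G -> leaf_free G -> T != set0 -> #|T| < touch T.
Proof.
move=> G_conn [S1 [S2 [S12 S1_cyc S2_cyc]]] G_lf T0.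
have [e0 _] : exists e : edge G, true.
  by case: S1_cyc => k /andP[_ /existsP[_ /existsP[g _]]]; exists (g ord0).
have deg2 (v : vertex G) : 2 <= degree v by exact: leaf_free_degree e0.
rewrite ltnNge; apply/negP => touch_le.
(* The degree sum over [T] lies between [2 * #|T|] and [2 * touch T]. The [?= iff] form keeps both
   equality cases: all degrees in [T] are 2, and every edge meeting [T] lies inside [T]. *)
have [degT degT_eq] : 2 * #|T| <= \sum_(v in T) degree v
    ?= iff [forall (v | v \in T), 2 == degree v].
  rewrite -sum1_card big_distrr /=; apply: leqif_sum => v _.
  by rewrite muln1; split=> //.
have [endT endT_eq] : \sum_(e : edge G) #|ends e :&: T| <= 2 * touch T
    ?= iff [forall (e | true), (ends e :&: T != set0) ==> (ends e \subset T)].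
  rewrite /touch -sum1_card big_distrr /= [X in _ <= X ?= iff _]big_mkcond /=; apply: leqif_sum => e _.
  rewrite inE; case: eqP => [-> | _] /=; first by rewrite cards0.
  have := subset_leqif_cards (subsetIl (ends e) T).
  rewrite card_ends muln1 => -[le eqv]; split=> //; rewrite eqv.
  by apply/eqP/setIidPl.
rewrite -sum_degree in endT endT_eq.
have sumE : \sum_(v in T) degree v = 2 * #|T|.
  apply/eqP; rewrite eqn_leq degT andbT (leq_trans endT) //.
  by rewrite leq_mul2l.
have touchE : touch T = #|T|.
  by apply/eqP; rewrite eqn_leq touch_le -(leq_pmul2l (m := 2)) // -sumE endT.
have TT : T = [set: vertex G].
  apply: closed_vset_full => // e meet; move: endT_eq.
  by rewrite sumE touchE eqxx => /esym/forall_inP/(_ e isT)/implyP; apply.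
have reg (v : vertex G) : degree v <= 2.
  move: degT_eq; rewrite sumE eqxx => /esym/forall_inP/(_ v).
  by rewrite TT inE => /(_ isT)/eqP <-.
by apply: S12; rewrite (two_regular_cycle G_conn reg S1_cyc)
  (two_regular_cycle G_conn reg S2_cyc).
Qed.

(** * Layer-cake summation over level sets *)

Lemma sum_ltn (N x : nat) : x <= N -> \sum_(t < N) (t < x : nat) = x.
Proof.
move=> xN; rewrite -(big_mkord xpredT (fun t => (t < x : nat))).
rewrite (big_cat_nat _ xN) //= [X in _ + X]big_nat_cond [X in _ + X]big1.
  rewrite addn0 big_nat_cond (eq_bigr (fun=> 1)).
    by rewrite -big_nat_cond sum_nat_const_nat subn0 muln1.
  by move=> t /andP[/andP[_ ->]].
by move=> t /andP[/andP[]]; rewrite leqNgt => /negPf ->.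
Qed.

Lemma ltn_bigmax (I : finType) (P : pred I) (F : I -> nat) (t : nat) :
  (t < \max_(i | P i) F i) = [exists i, P i && (t < F i)].
Proof.
apply/negb_inj; rewrite -leqNgt negb_exists.
apply/bigmax_leqP/forallP => [le i | no i Pi].
  by rewrite negb_and -leqNgt; case: (boolP (P i)) => //= /le.
by have := no i; rewrite Pi -leqNgt.
Qed.

(* Layer cake: sum [touch_gt] over the level sets of l. *)
Lemma sum_max_ends_ge (G : mgraph) (l : vertex G -> nat) :
  connected G -> multicyclic G -> leaf_free G ->
  \sum_v l v + \max_v l v <= \sum_(e : edge G) \max_(v in ends e) l v.
Proof.
move=> G_conn G_multi G_lf; set N := \max_v l v.
have lN v : l v <= N by apply: leq_bigmax.
have mN (e : edge G) : \max_(v in ends e) l v <= N.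
  by apply/bigmax_leqP => v _.
(* The surplus [N] becomes a 1 at each level [t < N], matching the strictness of [touch_gt] there;
   the level set is nonempty because [t] is below the maximum. *)
rewrite -[X in _ + X](sum_ltn (leqnn N)).
under eq_bigr => v _ do rewrite -(sum_ltn (lN v)).
under [X in _ <= X]eq_bigr => e _ do rewrite -(sum_ltn (mN e)).
rewrite exchange_big [X in _ <= X]exchange_big -big_split /=.
apply: leq_sum => t _; pose T := [set v | t < l v].
have -> : \sum_v (t < l v : nat) = #|T|.
  by rewrite -sum1_card [RHS]big_mkcond; apply: eq_bigr => v _; rewrite inE; case: ltnP.
have -> : \sum_(e : edge G) (t < \max_(v in ends e) l v : nat) = touch T.
  rewrite /touch -sum1_card [RHS]big_mkcond; apply: eq_bigr => e _.
  rewrite inE ltn_bigmax; have -> : [exists v, (v \in ends e) && (t < l v)] = (ends e :&: T != set0).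
    by apply/existsP/set0Pn => -[v]; exists v; move: p; rewrite !inE.
  by case: (_ != _).
have /existsP[v /= tv] : [exists v, true && (t < l v)].
  by rewrite -ltn_bigmax; exact: ltn_ord t.
rewrite ltn_ord addn1; apply: touch_gt => //.
by apply/set0Pn; exists v; rewrite inE.
Qed.

(** * From expected copies to a sum over vertex positions *)

(** Each copy is the image of some pair [(f, g)]. Letting [f] range over all maps only enlarges the
    bound and lets the sum factor over vertices later; injectivity of [g] is kept so that distinct
    edges of [H] use independent choices. *)
Lemma copies_le (H G : mgraph) :
  copies H G <= \sum_(f : {ffun vertex H -> vertex G})
                \sum_(g : {ffun edge H -> edge G} | injectiveb g)
                  [forall e : edge H, ends (g e) == f @: ends e].
Proof.
rewrite (eq_bigr (fun f : {ffun vertex H -> vertex G} =>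
  \sum_(g : {ffun edge H -> edge G})
    (injectiveb g && [forall e : edge H, ends (g e) == f @: ends e] : nat))); last first.
  by move=> f _; rewrite big_mkcond; apply: eq_bigr => g _; case: (injectiveb g).
rewrite pair_bigA /=.
pose P (p : {ffun vertex H -> vertex G} * {ffun edge H -> edge G}) : nat :=
  injectiveb p.2 && [forall e : edge H, ends (p.2 e) == p.1 @: ends e].
rewrite -[leqRHS]/(\sum_p P p).
pose A := [set p | 0 < P p].
have -> : \sum_p P p = #|A|.
  rewrite -sum1_card [RHS]big_mkcond; apply: eq_bigr => p _.
  by rewrite inE /P; case: (_ && _).
pose S (p : {ffun vertex H -> vertex G} * {ffun edge H -> edge G}) : vesets G :=
  (p.1 @: [set: vertex H], p.2 @: [set: edge H]).
apply: leq_trans (leq_imset_card S A); apply/subset_leq_card/subsetP => T.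
rewrite inE => /andP[_ /existsP[f /existsP[g /and5P[_ g_inj /eqP fT /eqP gT fg]]]].
apply/imsetP; exists (f, g); first by rewrite inE /P /= g_inj fg.
by rewrite /S fT gT; case: T {fT gT}.
Qed.

Lemma ua_source_max (m n : nat) (w : ua_outcome m n) (a : ua_edge m n)
    (V : finType) (f : V -> 'I_n) (B : {set V}) :
  [set ua_source a; ua_target w a] = f @: B ->
  ua_source a = \max_(v in B) f v :> nat.
Proof.
move=> aB; apply/eqP; rewrite eqn_leq; apply/andP; split.
  have /imsetP[v vB ->] : ua_source a \in f @: B by rewrite -aB set21.
  exact: (leq_bigmax_cond (F := fun v => f v : nat)).
apply/bigmax_leqP => v vB.
have : f v \in [set ua_source a; ua_target w a] by rewrite aB imset_f.
by case/set2P => -> //=; apply/ltnW/ltn_ord.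
Qed.

Local Open Scope ring_scope.

(** If some [g e] is not sent by the later end of [e], the event is empty. Otherwise each edge in
    the image of [g] has at most one admissible target, at probability [i^-1] for source [i], and
    all other edges are free and contribute a factor 1. *)
Lemma ua_prob_embedding (H : mgraph) (m n : nat) (f : vertex H -> 'I_n)
    (g : edge H -> ua_edge m n) :
  injective g ->
  \sum_(w : ua_outcome m n) ua_prob w *
     [forall e, [set ua_source (g e); ua_target w (g e)] == f @: ends e]%:R
  <= \prod_e ((ua_source (g e) == \max_(v in ends e) f v :> nat)%:R
              * (ua_source (g e))%:R^-1).
Proof.
move=> g_inj.
case: (boolP [forall e, ua_source (g e) == \max_(v in ends e) f v :> nat]);
    last first.
  case/forallPn => e ne; rewrite big1 => [|w _].
    by apply: prodr_ge0 => e' _; rewrite mulr_ge0 ?invr_ge0 ?ler0n.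
  case: forallP => [/(_ e)/eqP eqe|]; last by rewrite mulr0.
  by rewrite (ua_source_max eqe) eqxx in ne.
move=> /forallP src_max.
rewrite [leRHS](eq_bigr (fun e => (ua_source (g e))%:R^-1)); last first.
  by move=> e _; rewrite src_max mul1r.
(* [F a] collects the targets of [a] compatible with the embedding, and [c a] bounds their number;
   the event lies in the product of the [F a]. *)
pose F a : pred 'I_(ua_source a) := fun j => [forall e, (g e == a) ==>
  ([set ua_source a; widen_ord (ltnW (ltn_ord (ua_source a))) j] == f @: ends e)].
pose c a := if a \in [set g e | e : edge H] then 1%N else nat_of_ord (ua_source a).
have Fc a : (#|F a| <= c a)%N.
  rewrite /c; case: imsetP => [[e _ ae]|_]; last first.
    by apply: leq_trans (max_card _) _; rewrite card_ord.
  apply/card_le1P => i Fi j; apply/idP/eqP => [Fj|-> //].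
  have img k : k \in F a -> [set ua_source a; widen_ord (ltnW (ltn_ord (ua_source a))) k] = f @: ends e.
    by move/forallP/(_ e)/implyP=> Fk; apply/eqP/Fk; rewrite ae.
  have : widen_ord (ltnW (ltn_ord (ua_source a))) j \in
         [set ua_source a; widen_ord (ltnW (ltn_ord (ua_source a))) i].
    by rewrite (img i Fi) -(img j Fj) set22.
  case/set2P => /(congr1 val) /=; last exact: val_inj.
  by move=> ja; have := ltn_ord j; rewrite ja ltnn.
rewrite /ua_prob -big_distrr /= -natr_sum.
apply: (@le_trans _ _ (\prod_(a : ua_edge m n) (ua_source a)%:R^-1
                        * (\prod_(a : ua_edge m n) c a)%:R)).
  apply: ler_wpM2l; first by apply: prodr_ge0 => a _; rewrite invr_ge0.
  rewrite ler_nat; apply: (@leq_trans #|(family F : simpl_pred (ua_outcome m n))|).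
    rewrite -sum1_card [leqRHS]big_mkcond; apply: leq_sum => w _.
    case: forallP => // emb; case: ifP => // /negP[].
    apply/familyP => a; apply/forallP => e; apply/implyP => /eqP <-.
    exact: emb.
  rewrite card_family foldrE big_map big_enum /=.
  by apply: leq_prod => a _; exact: Fc.
rewrite natr_prod -big_split /= (bigID (mem [set g e | e : edge H])) /=.
rewrite [X in _ * X]big1 ?mulr1 => [|a /negPf na]; last first.
  rewrite /c na mulVf // pnatr_eq0 -lt0n; exact: (valP a.1).
rewrite (eq_bigr (fun a => (ua_source a)%:R^-1)) => [|a ga]; last first.
  by rewrite /c ga mulr1.
rewrite big_imset /=; last by move=> e1 e2 _ _; apply: g_inj.
by rewrite big_mkcond.
Qed.

Lemma expected_copies_le (H : mgraph) (m n : nat) :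
  expected_copies H m n <=
  m%:R ^+ #|edge H| * \sum_(f : {ffun vertex H -> 'I_n})
    \prod_(e : edge H) (2%:R^-1 ^+ (\max_(v in ends e) trunc_log 2 (f v))).
Proof.
rewrite /expected_copies /ua_expectation.
pose emb (w : ua_outcome m n) (f : {ffun vertex H -> 'I_n})
  (g : {ffun edge H -> ua_edge m n}) : rat :=
  [forall e, [set ua_source (g e); ua_target w (g e)] == f @: ends e]%:R.
apply: (@le_trans _ _ (\sum_(w : ua_outcome m n) ua_prob w *
   \sum_(f : {ffun vertex H -> 'I_n})
   \sum_(g : {ffun edge H -> ua_edge m n} | injectiveb g) emb w f g)).
  apply: ler_sum => w _; apply: ler_wpM2l.
    by apply: prodr_ge0 => a _; rewrite invr_ge0.
  have := copies_le H (ua_graph w); rewrite -(ler_nat rat) natr_sum.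
  under eq_bigr => f _ do rewrite natr_sum.
  by [].
under eq_bigr => w _ do
  (rewrite big_distrr /=; under eq_bigr => f _ do rewrite big_distrr /=).
rewrite exchange_big big_distrr /=; apply: ler_sum => f _.
rewrite exchange_big /=.
pose phi (e : edge H) (a : ua_edge m n) : rat :=
  (ua_source a == \max_(v in ends e) f v :> nat)%:R * (ua_source a)%:R^-1.
have phi_ge0 e a : 0 <= phi e a by rewrite mulr_ge0 ?invr_ge0 ?ler0n.
(* Adding the nonnegative terms of the non-injective [g] allows the sum over [g] to be distributed
   into a product over the edges of [H]. *)
apply: (@le_trans _ _ (\sum_(g : {ffun edge H -> ua_edge m n}) \prod_e phi e (g e))).
  rewrite [leRHS](bigID (fun g : {ffun edge H -> ua_edge m n} => injectiveb g)) /=.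
  rewrite -[leLHS]addr0 lerD //; last by apply: sumr_ge0 => g _; apply: prodr_ge0.
  by apply: ler_sum => g /injectiveP g_inj; apply: ua_prob_embedding.
rewrite -(bigA_distr_bigA phi) -prodr_const.
rewrite -[X in X * _]/(\prod_(e : edge H) m%:R) -big_split /=.
apply: ler_prod => e _; rewrite sumr_ge0 //=.
set M := (\max_(v in ends e) f v)%N.
set L := (\max_(v in ends e) trunc_log 2 (f v))%N.
have LM : (L <= trunc_log 2 M)%N.
  apply/bigmax_leqP => v ve; apply: leq_trunc_log.
  exact: (leq_bigmax_cond (F := fun v => f v : nat)).
have half_ge0 : 0 <= 2%:R^-1 ^+ L :> rat by rewrite exprn_ge0 ?invr_ge0.
(* Only edges sent by [M] count: there are at most [m] of them, and each has weight [M^-1], at most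
   [2^-L]. *)
apply: (@le_trans _ _ (\sum_(a : ua_edge m n) (ua_source a == M :> nat)%:R * 2%:R^-1 ^+ L)).
  apply: ler_sum => a _; rewrite /phi -/M; case: eqP => [aM|]; last by rewrite !mul0r.
  rewrite !mul1r exprVn lef_pV2 ?posrE ?exprn_gt0 // -?natrX ?ltr0n; last exact: (valP a.1).
  have M_gt0 : (0 < M)%N by rewrite -aM; exact: (valP a.1).
  have : (2 ^ trunc_log 2 M <= M)%N by exact: trunc_logP.
  by rewrite ler_nat aM; apply: leq_trans; rewrite leq_exp2l.
rewrite -mulr_suml ler_wpM2r //.
rewrite -(pair_bigA _ (fun (i : later n) (b : 'I_m) => (val i == M :> nat)%:R : rat)) /=.
under eq_bigr => i _ do rewrite sumr_const card_ord.
rewrite sumrMnl -[leRHS]mulr1 mulr_natl; apply: ler_wMn2r.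
rewrite -natr_sum -[1]/(1%:R) ler_nat.
case: (pickP (fun i : later n => val i == M :> nat)) => [i0 /eqP i0M|no].
  rewrite (bigD1 i0) //= big1 => [|i ne]; first by case: (_ == _).
  case: eqP => // iM; case/eqP: ne; apply/val_inj/val_inj.
  by rewrite /= iM i0M.
by rewrite big1 // => i _; rewrite no.
Qed.

(** * Convergence of the sum over positions *)

(** The block from [2^l] to [2^(l+1) - 1] has [2^l] terms [(q/2)^l], giving [q^l]. The extra 1 is
    the term [x = 0], where [trunc_log 2 0 = 0]. *)
Lemma sum_dyadic (q : rat) (N : nat) :
  \sum_(x < 2 ^ N) (q / 2%:R) ^+ trunc_log 2 x = 1 + \sum_(l < N) q ^+ l.
Proof.
elim: N => [|N IH].
  by rewrite expn0 big_ord_recl !big_ord0 /= trunc_log0.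
rewrite [in RHS]big_ord_recr /= addrA -IH.
rewrite -!(big_mkord xpredT (fun x => (q / 2%:R) ^+ trunc_log 2 x)).
rewrite (@big_cat_nat _ _ _ (2 ^ N)%N) //= ?leq_pexp2l //; congr (_ + _).
rewrite (eq_big_nat _ _ (F2 := fun=> (q / 2%:R) ^+ N)) => [|x xN]; last first.
  by rewrite (trunc_log_eq _ xN).
rewrite sumr_const_nat expnS mul2n -addnn addnK -[LHS]mulr_natr natrX -exprMn.
by rewrite divfK.
Qed.

Lemma sum_dyadic_le (q : rat) (n : nat) : 0 <= q < 1 ->
  \sum_(x < n) (q / 2%:R) ^+ trunc_log 2 x <= 1 + (1 - q)^-1.
Proof.
case/andP=> q0 q1.
have r0 x : 0 <= (q / 2%:R) ^+ trunc_log 2 x by rewrite exprn_ge0 // divr_ge0.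
apply: (@le_trans _ _ (\sum_(x < 2 ^ n) (q / 2%:R) ^+ trunc_log 2 x)).
  rewrite -!(big_mkord xpredT (fun x => (q / 2%:R) ^+ trunc_log 2 x)).
  rewrite [leRHS](@big_cat_nat _ _ _ n) //= ?lerDl ?sumr_ge0 //.
  exact/ltnW/ltn_expl.
rewrite sum_dyadic lerD2l -[leRHS]mul1r ler_pdivlMr ?subr_gt0 //.
by rewrite mulrC -opprB mulNr -subrX1 opprB gerBl exprn_ge0.
Qed.

Lemma bernoulli_sub (R : realDomainType) (x : R) (k : nat) :
  0 <= x <= 1 -> 1 - x *+ k <= (1 - x) ^+ k.
Proof.
case/andP=> x0 x1; elim: k => [|k IH]; first by rewrite subr0.
rewrite exprS; apply: (@le_trans _ _ ((1 - x) * (1 - x *+ k))).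
  rewrite mulrS; have : 0 <= x * (x *+ k) by rewrite mulr_ge0 ?mulrn_wge0.
  by move: (x *+ k) => y; lra.
by rewrite ler_wpM2l ?subr_ge0.
Qed.

(* q = 1 - 1/(2k) satisfies q^k >= 1/2, so that the surplus factor 2^-(max l)
   pays for a factor q^(l v) at each of the k vertices, which makes the sum
   over each position of f converge geometrically. *)
Lemma prod_half_le (H : mgraph) (l : vertex H -> nat)
    (q := 1 - (2 * #|vertex H|)%:R^-1 : rat) :
  connected H -> multicyclic H -> leaf_free H ->
  \prod_(e : edge H) 2%:R^-1 ^+ (\max_(v in ends e) l v)
    <= \prod_v (q / 2%:R) ^+ l v.
Proof.
move=> H_conn H_multi H_lf; have [k_gt0 _] := H_conn.
set k := #|vertex H| in q k_gt0 *.
have x0 : 0 <= (2 * k)%:R^-1 :> rat by rewrite invr_ge0.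
have x1 : (2 * k)%:R^-1 <= 1 :> rat by rewrite invf_le1 ?ltr0n ?ler1n ?muln_gt0.
have q_ge0 : 0 <= q by rewrite subr_ge0.
have q_le1 : q <= 1 by rewrite gerBl.
have qk : 2%:R^-1 <= q ^+ k.
  apply: le_trans (bernoulli_sub _ _); last by rewrite x0.
  have -> : (2 * k)%:R^-1 *+ k = 2%:R^-1 :> rat; last by lra.
  by rewrite -[LHS]mulr_natr natrM invfM divfK // pnatr_eq0 -lt0n.
rewrite !prodrXr exprMn.
set M := \max_v l v.
apply: (@le_trans _ _ (2%:R^-1 ^+ (\sum_v l v + M))).
  by apply: ler_wiXn2l; rewrite ?invr_ge0 ?invf_le1 ?sum_max_ends_ge.
rewrite exprD mulrC ler_wpM2r ?exprn_ge0 ?invr_ge0 //.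
(* Since each [l v] is at most [M], the exponent [k * M] covers the sum of all [l v], and [q] is at
   most 1. *)
apply: (@le_trans _ _ ((q ^+ k) ^+ M)); first by rewrite lerXn2r ?nnegrE ?invr_ge0 ?exprn_ge0.
rewrite -exprM; apply: ler_wiXn2l => //.
rewrite -sum_nat_const; apply: leq_sum => v _; exact: leq_bigmax.
Qed.

Theorem theorem3p11 (H : mgraph) (m : nat) (H_connected : connected H)
    (H_multicyclic : multicyclic H) (H_leaf_free : leaf_free H)
    (m_ge2 : (2 <= m)%N) :
  exists C : rat, forall n : nat, (1 <= n)%N -> expected_copies H m n <= C.
Proof.
pose q : rat := 1 - (2 * #|vertex H|)%:R^-1.
have k_gt0 : (0 < 2 * #|vertex H|)%N by rewrite muln_gt0; case: H_connected.
have q01 : 0 <= q < 1.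
  by rewrite subr_ge0 invf_le1 ?ltr0n ?ler1n // k_gt0 gtrBl invr_gt0 ltr0n.
(* One factor [m] per edge for its label, and one dyadic sum per vertex for its position; here
   [(1 - q)^-1] is twice the number of vertices of [H]. *)
exists (m%:R ^+ #|edge H| * (1 + (1 - q)^-1) ^+ #|vertex H|) => n _.
apply: le_trans (expected_copies_le H m n) _.
rewrite ler_wpM2l ?exprn_ge0 //.
apply: (@le_trans _ _ (\sum_(f : {ffun vertex H -> 'I_n})
    \prod_v (q / 2%:R) ^+ trunc_log 2 (f v))).
  by apply: ler_sum => f _; apply: (prod_half_le (fun v => trunc_log 2 (f v))).
rewrite -(bigA_distr_bigA (fun (v : vertex H) (x : 'I_n) => (q / 2%:R) ^+ trunc_log 2 x)).
rewrite prodr_const; apply: lerXn2r; rewrite ?nnegrE ?sum_dyadic_le //.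
- apply: sumr_ge0 => x _; rewrite exprn_ge0 // divr_ge0 //; by case/andP: q01.
- by rewrite addr_ge0 // invr_ge0 subr_ge0; case/andP: q01 => _ /ltW.
Qed.
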